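(* Let $k,n\ge 1$ and $r\ge 0$ be integers, $p\in(0,1)$, $q=1-p$. Let $M_n^{(k)}$ be the number of success runs with length $k$ or more in $n$ independent Bernoulli trials with success probability $p$. Then $$\mathbb{P}(M_n^{(k)}=r)=\sum_{m=r}^{\left\lfloor\frac{n+1}{k+1}\right\rfloor}(-1)^{m-r}\binom{m}{r}p^{mk}q^{m-1}\left[\binom{n-mk+1}{m}-p\binom{n-mk}{m}\right].$$
   Context: Here a success run is a maximal block of consecutive successes (Type II counting: distinct runs are separated by at least one failure), and $M_n^{(k)}$ counts those maximal blocks whose length is at least $k$. Conventions: $\binom{a}{b}=0$ unless $0\le b\le a$, and an empty sum is $0$. (Muselli's known formula for the same probability has the bracket $\binom{n-mk}{m-1}+q\binom{n-mk}{m}$ in place of the bracket above.) *)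

(* Defs.v *)
From HB Require Import structures.
From mathcomp Require Import all_boot all_order all_algebra.
From mathcomp Require Import all_classical all_reals all_analysis.

Set Implicit Arguments.
Unset Strict Implicit.
Unset Printing Implicit Defensive.

Import Order.TTheory GRing.Theory Num.Theory.

Local Open Scope ring_scope.

(* A block of successes of the outcome x (true = success): a nonempty set of
   consecutive trials, all of which are successes. *)
Definition success_block (n : nat) (x : {ffun 'I_n -> bool}) (B : {set 'I_n}) :
    bool :=
  [exists i : 'I_n, exists j : 'I_n,
     [&& (i <= j)%N, B == [set l : 'I_n | (i <= l <= j)%N]%SET
       & [forall l in B, x l]]].

(* The success runs of x: the inclusion-maximal blocks of successes. *)
Definition success_runs (n : nat) (x : {ffun 'I_n -> bool}) :
    {set {set 'I_n}} :=
  [set B : {set 'I_n} | maxset (success_block x) B]%SET.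

Definition num_success_runs (n : nat) (k : nat) (x : {ffun 'I_n -> bool}) :
    nat :=
  #|[set B in success_runs x | (k <= #|B|)%N]%SET|.

(* Mutual independence: the product rule over every finite subfamily and every
   choice of measurable sets. *)
Definition mutually_independent (R : realType) (d d' : measure_display)
    (T : measurableType d) (T' : measurableType d') (P : probability T R)
    (I : finType) (X : I -> {RV P >-> T'}) : Prop :=
  forall (J : {set I}) (B : I -> set T'),
    (forall i, i \in J -> measurable (B i)) ->
    P (\bigcap_(i in [set` J]) (X i @^-1` B i))%classic =
    (\prod_(i in J) P (X i @^-1` B i)%classic)%E.

Definition bernoulli_trials (R : realType) (d : measure_display)
    (T : measurableType d) (P : probability T R) (n : nat)
    (X : 'I_n -> {RV P >-> bool}) (p : R) : Prop :=
  mutually_independent X /\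
  forall i : 'I_n, distribution P (X i) =1 bernoulli_prob p.

(* M_n^(k) as a function on the sample space. *)
Definition M (R : realType) (d : measure_display) (T : measurableType d)
    (P : probability T R) (n k : nat) (X : 'I_n -> {RV P >-> bool}) (t : T) :
    nat :=
  num_success_runs k [ffun i => X i t].

(* Main.v *)
Require Import Defs.
From HB Require Import structures.
From mathcomp Require Import all_boot all_order all_algebra.
From mathcomp Require Import all_classical all_reals all_analysis.
From mathcomp Require Import zify ring.

Set Implicit Arguments.
Unset Strict Implicit.
Unset Printing Implicit Defensive.

Import Order.TTheory GRing.Theory Num.Theory.

(** The argument goes through binomial moments.  Writing N for the number of
    success runs of length at least k, binomial inversion gives
    1_{N = r} = sum_m (-1)^(m-r) C(m,r) C(N,m) ([indicator_binomial_inversion]),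
    so the claim reduces to
    E[C(N,m)] = p^(mk) q^(m-1) [C(n-mk+1,m) - p C(n-mk,m)].

    A maximal run is determined by its first trial, so N counts the positions
    that follow a failure (or open the sequence) and are followed by k successes
    ([num_success_runsE]).  This count is local, which allows conditioning on
    the first trials: let F_n(m) and G_n(m) be the binomial moments of the count
    over n trials that are preceded by a failure, resp. by a success.  The two
    counts agree except when the first k trials all succeed, in which case the
    first one is larger by 1; as C(N+1,m+1) - C(N,m+1) = C(N,m),
      F_n(m+1) = G_n(m+1) + p^k G_(n-k)(m)    for n >= k,
      G_(n+1)(m) = p G_n(m) + q F_n(m).
    Eliminating F leaves G_(n+1)(m+1) = G_n(m+1) + q p^k G_(n-k)(m), which is
    Pascal's rule in disguise: G_n(m) = q^m p^(mk) C(n-mk,m)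
    ([binomial_moment_true]).  Substituting back yields the bracket
    ([binomial_moment_false]).  F_n(m) vanishes for m > (n+1)/(k+1)
    ([binomial_moment_false_eq0]), whence the upper limit of the sum.

    The probability space enters only through [outcomes_probability]:
    independence gives each outcome of the n trials its product weight. *)

(** * Success runs and their first trials *)

Section Runs.
Variables (n : nat) (x : {ffun 'I_n -> bool}).

(** The trials from [i] up to the next failure. *)
Definition successes_from (i : 'I_n) : {set 'I_n} :=
  [set l : 'I_n | (i <= l)%N && [forall h : 'I_n, (i <= h <= l)%N ==> x h]].

Definition run_start (i : 'I_n) : bool :=
  x i && [forall h : 'I_n, (h.+1 == i) ==> ~~ x h].

Lemma success_blockP (B : {set 'I_n}) :
  reflect (exists i j : 'I_n, [/\ (i <= j)%N,
     forall l, (l \in B) = (i <= l <= j)%N & forall l, l \in B -> x l])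
    (success_block x B).
Proof.
apply: (iffP existsP) => [[i /existsP[j /and3P[le_ij /eqP-> /forall_inP xB]]]|].
  by exists i, j; split=> // l; rewrite inE.
move=> [i [j [le_ij mB xB]]]; exists i; apply/existsP; exists j.
rewrite le_ij /=; apply/andP; split; last by apply/forall_inP.
by apply/eqP/setP => l; rewrite mB inE.
Qed.

Lemma successes_fromP (i l : 'I_n) :
  reflect ((i <= l)%N /\ forall h : 'I_n, (i <= h <= l)%N -> x h)
    (l \in successes_from i).
Proof.
rewrite inE; apply: (iffP andP) => [[le_il /forallP xil]|[le_il xil]].
  by split=> // h; apply/implyP.
by split=> //; apply/forallP => h; apply/implyP/xil.
Qed.

Lemma mem_successes_from i : x i -> i \in successes_from i.
Proof.
move=> xi; apply/successes_fromP; split=> // h; rewrite -eqn_leq => /eqP ih.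
by rewrite -(ord_inj ih).
Qed.

Lemma successes_from_block i : x i -> success_block x (successes_from i).
Proof.
move=> xi; have Pi := mem_successes_from xi.
have [j jP j_max] := @arg_maxnP _ i (mem (successes_from i)) (@nat_of_ord n) Pi.
apply/success_blockP; exists i, j.
have [le_ij xij] := successes_fromP _ _ jP.
split=> // [l|l /successes_fromP[le_il]]; last by apply; rewrite le_il /=.
apply/idP/andP => [lP|[le_il le_lj]].
  by split; [case/successes_fromP: lP | apply: j_max].
apply/successes_fromP; split=> // h /andP[le_ih le_hl].
by apply: xij; rewrite le_ih (leq_trans le_hl).
Qed.

(** A larger block would have to reach further left, through the failure that
    precedes [i], or further right, through the failure that ends
    [successes_from i]. *)
Lemma successes_from_run i :
  run_start i -> successes_from i \in success_runs x.
Proof.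
move=> /andP[xi /forallP start_i]; rewrite inE; apply/maxsetP.
split=> [|B /success_blockP[i' [j [le_ij mB xB]]] sub_B].
  exact: successes_from_block.
have := fintype.subsetP sub_B _ (mem_successes_from xi).
rewrite mB => /andP[le_i'i le_i_j].
have eq_i : i' = i :> nat.
  apply/eqP; rewrite eqn_leq le_i'i leqNgt; apply/negP => lt_i'i.
  have lt_n : (i.-1 < n)%N by apply: leq_ltn_trans (ltn_ord i); apply: leq_pred.
  have := start_i (Ordinal lt_n); rewrite /= (ltn_predK lt_i'i) eqxx /=.
  by rewrite xB // mB /=; lia.
apply/eqP; rewrite finset.eqEsubset sub_B andbT; apply/fintype.subsetP => l lB.
move: (lB); rewrite mB => /andP[le_i'l le_lj].
apply/successes_fromP; split=> [|h /andP[le_ih le_hl]]; first by rewrite -eq_i.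
by apply: xB; rewrite mB eq_i le_ih (leq_trans le_hl).
Qed.

(** Conversely, the least element of a maximal block follows a failure, since
    otherwise the block could be extended by one trial to the left. *)
Lemma success_runsP (B : {set 'I_n}) :
  reflect (exists2 i, run_start i & B = successes_from i) (B \in success_runs x).
Proof.
apply: (iffP idP) => [|[i start_i ->]]; last exact: successes_from_run.
rewrite inE => /maxsetP[/success_blockP[i [j [le_ij mB xB]]] B_max].
have iB : i \in B by rewrite mB leqnn.
exists i; last first.
  apply/esym/B_max; first exact/successes_from_block/xB.
  apply/fintype.subsetP => l lB; move: (lB); rewrite mB => /andP[le_il le_lj].
  apply/successes_fromP; split=> // h /andP[le_ih le_hl].
  by apply: xB; rewrite mB le_ih (leq_trans le_hl).
rewrite /run_start xB //; apply/forallP => h; apply/implyP => /eqP hi.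
apply/negP => xh; pose B' := [set l : 'I_n | h <= l <= j]%SET.
have B'E : B' = B.
  apply: B_max; last by apply/fintype.subsetP => l; rewrite mB inE; lia.
  apply/success_blockP; exists h, j; split=> [|l|l]; [lia | by rewrite inE |].
  rewrite inE => /andP[]; rewrite leq_eqVlt => /orP[/eqP/ord_inj<- //|lt_hl le_lj].
  by apply: xB; rewrite mB -hi lt_hl.
by have : h \in B' by [rewrite inE leqnn /=; lia]; rewrite B'E mB; lia.
Qed.

Lemma successes_from_inj : {in run_start &, injective successes_from}.
Proof.
move=> i j /andP[xi _] /andP[xj _] eq_ij; apply/ord_inj/eqP; rewrite eqn_leq.
have := mem_successes_from xi; rewrite eq_ij => /successes_fromP[-> _].
by have := mem_successes_from xj; rewrite -eq_ij => /successes_fromP[-> _].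
Qed.

Lemma card_ord_itv i j : (j <= n)%N -> #|[set l : 'I_n | i <= l < j]%SET| = j - i.
Proof.
move=> le_jn; rewrite -sum1_card -[RHS]mul1n mulnC -sum_nat_const_nat.
rewrite (big_nat_widen _ _ _ _ _ le_jn) big_geq_mkord /=.
by apply: eq_bigl => l; rewrite inE andbC.
Qed.

Lemma leq_card_successes_from k i : (0 < k)%N ->
  (k <= #|successes_from i|) =
    (i + k <= n)%N && [forall l : 'I_n, (i <= l < i + k)%N ==> x l].
Proof.
move=> k_gt0; apply/idP/andP => [le_k|[le_n /forallP xik]]; last first.
  have <- : #|[set l : 'I_n | i <= l < i + k]%SET| = k by rewrite card_ord_itv // addKn.
  apply/subset_leq_card/fintype.subsetP => l; rewrite inE => /andP[le_il lt_l].
  apply/successes_fromP; split=> // h /andP[le_ih le_hl].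
  by apply: (implyP (xik h)); rewrite le_ih (leq_ltn_trans le_hl).
(* If every element of the run were below i + k - 1, the run would have fewer
   than k elements. *)
have [l lP le_l] : exists2 l, l \in successes_from i & (i + k <= l.+1)%N.
  apply/exists_inP; apply: contraT => /existsPn h.
  have : successes_from i \subset [set l : 'I_n | i <= l < minn (i + k.-1) n]%SET.
    apply/fintype.subsetP => l lP; rewrite inE.
    have := h l; rewrite lP; have := ltn_ord l.
    by have [] := successes_fromP _ _ lP; lia.
  by move=> /subset_leq_card; rewrite card_ord_itv ?geq_minr //; lia.
have [le_il xil] := successes_fromP _ _ lP.
split; first exact: leq_trans le_l (ltn_ord l).
by apply/forallP => h; apply/implyP => ?; apply: xil; lia.
Qed.

End Runs.

Local Open Scope ring_scope.

(** * Binomial inversion *)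

Lemma bin_trinomial (N m r : nat) :
  (r <= m)%N -> ('C(N, m) * 'C(m, r) = 'C(N, r) * 'C(N - r, m - r))%N.
Proof.
move=> le_rm; have [le_mN | lt_Nm] := leqP m N; last first.
  rewrite bin_small // mul0n; have [le_rN | lt_Nr] := leqP r N.
    by rewrite (@bin_small (N - r)) ?muln0 //; lia.
  by rewrite bin_small.
have le_rN := leq_trans le_rm le_mN.
have le_sub : (m - r <= N - r)%N by lia.
have f_gt0 : (0 < r`! * (m - r)`! * (N - m)`!)%N by rewrite !muln_gt0 !fact_gt0.
apply/eqP; rewrite -(eqn_pmul2r f_gt0); apply/eqP.
have e1 := bin_fact le_mN; have e2 := bin_fact le_rm.
have e3 := bin_fact le_rN; have e4 := bin_fact le_sub.
have e5 : (N - r - (m - r) = N - m)%N by lia.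
rewrite e5 in e4; transitivity N`!.
  by rewrite -e1 -e2; ring.
by rewrite -e3 -e4; ring.
Qed.

(** By trinomial revision C(N,m) C(m,r) = C(N,r) C(N-r,m-r), the sum is
    C(N,r) (1 - 1)^(N-r). *)
Lemma indicator_binomial_inversion (R : comNzRingType) (N r b : nat) :
  (N < b)%N ->
  (N == r)%:R =
    \sum_(r <= m < b) (-1) ^+ (m - r) * 'C(m, r)%:R * 'C(N, m)%:R :> R.
Proof.
move=> lt_Nb; have [lt_Nr | le_rN] := ltnP N r.
  rewrite (ltn_eqF lt_Nr) big_nat big1 // => m /andP[le_rm _].
  by rewrite (bin_small (leq_trans lt_Nr le_rm)) mulr0.
(* The terms with m > N vanish, so the sum may be cut at m = N. *)
rewrite (@big_cat_nat _ _ _ N.+1) //=; last by lia.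
rewrite [X in _ + X]big_nat [X in _ + X]big1 ?addr0; last first.
  by move=> m /andP[lt_Nm _]; rewrite (@bin_small N m) ?mulr0.
rewrite -{2}[r]add0n big_addn big_mkord subSn //.
transitivity ('C(N, r)%:R * (1 - 1) ^+ (N - r) :> R).
  rewrite subrr expr0n subn_eq0; have [le_Nr | lt_rN] := leqP N r.
    have -> : N = r by apply/eqP; rewrite eqn_leq le_Nr.
    by rewrite eqxx binn mulr1.
  by rewrite (gtn_eqF lt_rN) mulr0.
rewrite exprBn mulr_sumr; apply: eq_bigr => i _.
rewrite addnK !expr1n !mulr1 -mulrA -natrM mulnC.
rewrite bin_trinomial ?leq_addl // addnK natrM -mulr_natr; ring.
Qed.

(** * Run starts in a sequence of outcomes *)

(** The number of positions of [s] at which a run of at least [k] successes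
    starts, when the trial just before [s] had outcome [b].  In [b :: s] the
    entry of index [i] is the trial that precedes position [i] of [s]. *)
Definition run_starts (k : nat) (b : bool) (s : seq bool) : nat :=
  \sum_(i < size s) (~~ nth b (b :: s) i && prefix (nseq k true) (drop i s)).

Lemma run_starts_cons k b x s :
  run_starts k b (x :: s) =
    ((~~ b && prefix (nseq k true) (x :: s)) + run_starts k x s)%N.
Proof.
rewrite /run_starts big_ord_recl; congr (_ + _)%N; apply: eq_bigr => i _.
by rewrite lift0 /= (set_nth_default x) // ltnS ltnW.
Qed.

(** The trial before [s] only matters for position 0. *)
Lemma run_starts_false k s :
  (0 < k)%N ->
  run_starts k false s = (prefix (nseq k true) s + run_starts k true s)%N.
Proof.
case: s => [|x s] k_gt0; last by rewrite !run_starts_cons.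
by rewrite /run_starts !big_ord0 addn0; case: k k_gt0.
Qed.

(** The default value [false] makes the right-hand side force [k <= size s]. *)
Lemma prefix_nseqP k (s : seq bool) :
  reflect (forall j, (j < k)%N -> nth false s j) (prefix (nseq k true) s).
Proof.
elim: k s => [|k IHk] s /=; first by rewrite prefix0s; left.
case: s => [|b s] /=; first by right=> /(_ 0%N isT).
apply: (iffP andP) => [[/eqP<- /IHk s_k] [|j] //= | b_s].
  exact: s_k.
split; first by have := b_s 0%N isT; case: b {b_s}.
by apply/IHk => j lt_jk; apply: (b_s j.+1).
Qed.

Lemma run_starts_at k n (t : n.-tuple bool) (i : 'I_n) (x := [ffun i => tnth t i]) :
  (0 < k)%N ->
  (run_start x i && (k <= #|successes_from x i|)%N) =
    ~~ nth false (false :: t) i && prefix (nseq k true) (drop i t).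
Proof.
move=> k_gt0; have xE (l : 'I_n) : x l = nth false t l.
  by rewrite ffunE (tnth_nth false).
rewrite leq_card_successes_from //.
have -> : (i + k <= n)%N && [forall l : 'I_n, (i <= l < i + k)%N ==> x l] =
          prefix (nseq k true) (drop i t).
  apply/andP/prefix_nseqP => [[le_n /forallP xik] j lt_jk|t_ik].
    have lt_n : (i + j < n)%N by lia.
    rewrite nth_drop -(xE (Ordinal lt_n)).
    by apply: (implyP (xik (Ordinal lt_n))) => /=; lia.
  split.
    rewrite leqNgt; apply/negP => lt_n.
    have := t_ik k.-1; rewrite nth_drop nth_default ?size_tuple; last by lia.
    by move/(_ (ltac:(lia))).
  apply/forallP => l; apply/implyP => /andP[le_il lt_l].
  by have := t_ik (l - i)%N; rewrite nth_drop subnKC // -xE; apply; lia.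
case t_ik: (prefix _ _); last by rewrite !andbF.
have /prefix_nseqP/(_ 0%N k_gt0) := t_ik; rewrite nth_drop addn0 -xE => xi.
rewrite !andbT /run_start xi /=; case: i xi {t_ik} => [[|i] lt_in] xi /=.
  by apply/forallP => h.
apply/forallP/idP => [/(_ (Ordinal (ltnW lt_in)))|nt_i h].
  by rewrite /= eqxx xE.
by apply/implyP => /eqP[hi]; rewrite xE hi.
Qed.

(** The map [successes_from] matches run starts with runs. *)
Lemma num_success_runsE k n (t : n.-tuple bool) : (0 < k)%N ->
  num_success_runs k [ffun i => tnth t i] = run_starts k false t.
Proof.
move=> k_gt0; set x := [ffun i => _].
pose S := [set i | run_start x i && (k <= #|successes_from x i|)%N]%SET.
transitivity #|S|.
  rewrite -(@card_in_imset _ _ (successes_from x) (mem S)); last first.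
    move=> i j; rewrite !finset.inE => /andP[si _] /andP[sj _].
    exact: successes_from_inj.
  rewrite /num_success_runs; apply: eq_card => B; rewrite finset.in_set.
  apply/andP/imsetP => [[/success_runsP[i si ->] le_k]|[i]].
    by exists i => //; rewrite finset.inE si.
  by rewrite finset.inE => /andP[si le_k] ->; split=> //; apply/success_runsP; exists i.
rewrite -sum1_card big_mkcond /run_starts /=.
rewrite -(big_mkord xpredT (fun i => nat_of_bool
  (~~ nth false (false :: t) i && prefix (nseq k true) (drop i t)))).
rewrite size_tuple big_mkord; apply: eq_bigr => i _.
by rewrite finset.inE run_starts_at //; case: (_ && _).
Qed.

Lemma run_starts_leq_size k b s : (run_starts k b s <= size s)%N.
Proof.
rewrite /run_starts -[X in (_ <= X)%N]card_ord -sum1_card.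
by apply: leq_sum => i _; case: (_ && _).
Qed.

(** * Binomial moments of the number of run starts *)

Section Mean.
Variables (R : comNzRingType) (p : R).

(** The expectation of [f] over [n] Bernoulli trials, computed by conditioning on
    the first trial; [trials_meanE] is the closed form. *)
Fixpoint trials_mean (n : nat) (f : seq bool -> R) : R :=
  if n is n'.+1 then
    p * trials_mean n' (fun s => f (true :: s)) +
    (1 - p) * trials_mean n' (fun s => f (false :: s))
  else f [::].

Lemma eq_trials_mean n f g :
  (forall s, size s = n -> f s = g s) -> trials_mean n f = trials_mean n g.
Proof.
elim: n f g => [|n IHn] f g efg /=; first exact: efg.
by congr (_ * _ + _ * _); apply: IHn => s sz_s; apply: efg; rewrite /= sz_s.
Qed.

Lemma trials_mean0 n : trials_mean n (fun=> 0) = 0.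
Proof. by elim: n => //= n ->; rewrite !mulr0 addr0. Qed.

Lemma trials_meanD n f g :
  trials_mean n (fun s => f s + g s) = trials_mean n f + trials_mean n g.
Proof. by elim: n f g => //= n IHn f g; rewrite !IHn; ring. Qed.

Lemma trials_meanZ n a f :
  trials_mean n (fun s => a * f s) = a * trials_mean n f.
Proof. by elim: n f => //= n IHn f; rewrite !IHn; ring. Qed.

Lemma trials_mean_sum n (r : seq nat) (a : nat -> R) (f : nat -> seq bool -> R) :
  trials_mean n (fun s => \sum_(m <- r) a m * f m s) =
    \sum_(m <- r) a m * trials_mean n (f m).
Proof.
elim: r => [|m r IHr].
  rewrite big_nil -[RHS](trials_mean0 n).
  by apply: eq_trials_mean => s _; rewrite big_nil.
rewrite big_cons -IHr -trials_meanZ -trials_meanD.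
by apply: eq_trials_mean => s _; rewrite big_cons.
Qed.

Lemma trials_meanE n f :
  trials_mean n f =
    \sum_(t : n.-tuple bool) (\prod_(i < n) if tnth t i then p else 1 - p) * f t.
Proof.
elim: n f => [|n IHn] f /=.
  rewrite (big_pred1 [tuple]) => [|t]; first by rewrite big_ord0 mul1r.
  by rewrite [t]tuple0 /= eqxx.
pose h (u : bool * n.-tuple bool) := [tuple of u.1 :: u.2].
pose h' (t : n.+1.-tuple bool) := (thead t, [tuple of behead t]).
rewrite (reindex_onto h h') => [|t _]; last by rewrite [RHS]tuple_eta.
transitivity (\sum_(x : bool) \sum_(t : n.-tuple bool)
    (if x then p else 1 - p) *
    ((\prod_(i < n) if tnth t i then p else 1 - p) * f (x :: t))).
  rewrite big_bool /= -!mulr_sumr !IHn; congr (_ + _).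
rewrite pair_big /=; apply: eq_big => [[x t]|[x t] _] /=.
  by rewrite /h' /h theadE /=; apply/esym/eqP; congr pair; apply: val_inj.
rewrite big_ord_recl mulrA; congr (_ * _ * _).
by apply: eq_bigr => i _; rewrite tnthS.
Qed.

(** Given that the first [j] trials succeed, the count after a success only
    depends on the remaining [n - j] trials: no run starts right after a
    success. *)
Lemma trials_mean_prefix k j n (f : nat -> R) :
  trials_mean n (fun s =>
      (prefix (nseq j true) s)%:R * f (run_starts k true s)) =
    (j <= n)%:R * p ^+ j *
    trials_mean (n - j) (fun s => f (run_starts k true s)).
Proof.
elim: j n => [|j IHj] n.
  rewrite subn0 expr0 !mul1r; apply: eq_trials_mean => s _.
  by rewrite /= prefix0s mul1r.
case: n => [|n] /=; first by rewrite !mul0r.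
rewrite (eq_trials_mean _ (g := fun s =>
    (prefix (nseq j true) s)%:R * f (run_starts k true s))); last first.
  by move=> s _; rewrite run_starts_cons.
rewrite [X in _ + _ * X](eq_trials_mean _ (g := fun=> 0)); last first.
  by move=> s _; rewrite mul0r.
by rewrite IHj trials_mean0 ltnS subSS exprS; ring.
Qed.

(** G_n(m) for [b = true] and F_n(m) for [b = false]. *)
Definition binomial_moment k b n m : R :=
  trials_mean n (fun s => 'C(run_starts k b s, m)%:R).

(** When the first [k] trials succeed, the count after a failure exceeds the count
    after a success by 1, and C(N+1,m+1) - C(N,m+1) = C(N,m). *)
Lemma binomial_moment_falseS k n m : (0 < k)%N ->
  binomial_moment k false n m.+1 =
    binomial_moment k true n m.+1 +
    (k <= n)%:R * p ^+ k * binomial_moment k true (n - k) m.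
Proof.
move=> k_gt0; rewrite /binomial_moment.
rewrite -(trials_mean_prefix k k n (fun N => 'C(N, m)%:R)).
rewrite -trials_meanD; apply: eq_trials_mean => s _.
rewrite run_starts_false //; case: prefix; last by rewrite mul0r addr0 add0n.
by rewrite mul1r add1n binS natrD.
Qed.

Lemma binomial_moment_trueS k n m :
  binomial_moment k true n.+1 m =
    p * binomial_moment k true n m + (1 - p) * binomial_moment k false n m.
Proof.
rewrite /binomial_moment /=.
by congr (_ * _ + _ * _); apply: eq_trials_mean => s _; rewrite run_starts_cons.
Qed.

Lemma trials_mean1 n : trials_mean n (fun=> 1) = 1.
Proof. by elim: n => //= n ->; ring. Qed.

Lemma binomial_moment0 k b n : binomial_moment k b n 0 = 1.
Proof.
rewrite /binomial_moment -[RHS](trials_mean1 n).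
by apply: eq_trials_mean => s _; rewrite bin0.
Qed.

(** Induction on [n] with G_(n+1)(m+1) = G_n(m+1) + q p^k G_(n-k)(m).  The
    truncated subtraction is harmless: when [n < m * k] the coefficient is
    C(0,m) with [m > 0], hence 0. *)
Lemma binomial_moment_true k n m : (0 < k)%N ->
  binomial_moment k true n m = (1 - p) ^+ m * p ^+ (m * k) * 'C(n - m * k, m)%:R.
Proof.
move=> k_gt0; elim/ltn_ind: n m => n IHn [|m].
  by rewrite binomial_moment0 mul0n subn0 bin0 !expr0 !mulr1.
case: n IHn => [|n] IHn.
  by rewrite /binomial_moment /= /run_starts big_ord0 /= sub0n bin0n !mulr0.
rewrite binomial_moment_trueS binomial_moment_falseS // !IHn //; last first.
  by rewrite ltnS leq_subr.
have [le_kn|lt_nk] := leqP k n; last first.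
  (* Fewer than k + 1 trials: no run can start after a first failure. *)
  rewrite (_ : n - _ = 0)%N; last by nia.
  rewrite (_ : n.+1 - _ = 0)%N; last by nia.
  by rewrite bin0n /= !mulr0n; ring.
rewrite -subnDA -[(k + m * k)%N]/(m.+1 * k)%N.
have [lt|le] := ltnP n (m.+1 * k).
  rewrite (_ : n - _ = 0)%N; last by lia.
  rewrite (_ : n.+1 - _ = 0)%N; last by lia.
  case: m lt {IHn} => [|m] lt; first by move: lt; lia.
  by rewrite !bin0n !mulr0n; ring.
rewrite subSn // binS natrD mulSn exprD !exprS /=.
by move: (_ ^+ m) (_ ^+ (m * k)) ('C(_, m.+1)%:R) ('C(_, m)%:R) => a b c d; ring.
Qed.

(** Both sides are multiplied by [1 - p] to avoid the exponent -1 at [m = 0].  The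
    bound on [m] is what makes [n - m * k] a true difference. *)
Lemma binomial_moment_false k n m : (0 < k)%N ->
  (m * k.+1 <= n.+1)%N ->
  (1 - p) * binomial_moment k false n m =
    p ^+ (m * k) * (1 - p) ^+ m *
      ('C(n - m * k + 1, m)%:R - p * 'C(n - m * k, m)%:R).
Proof.
move=> k_gt0 le_m; case: m le_m => [|m] le_m.
  by rewrite binomial_moment0 mul0n !bin0 !expr0; ring.
have le_kn : (k <= n)%N by nia.
rewrite binomial_moment_falseS // !binomial_moment_true // le_kn.
rewrite -subnDA -[(k + m * k)%N]/(m.+1 * k)%N addn1 binS natrD.
rewrite mulSn exprD !exprS /=.
by move: (_ ^+ m) (_ ^+ (m * k)) ('C(_, m.+1)%:R) ('C(_, m)%:R) => a b c d; ring.
Qed.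

(** [m] runs of length [k] need [m - 1] failures between them, that is
    [m * k.+1 <= n.+1]. *)
Lemma binomial_moment_false_eq0 k n m : (0 < k)%N ->
  (n.+1 < m * k.+1)%N -> binomial_moment k false n m = 0.
Proof.
move=> k_gt0 lt_m; case: m lt_m => [//|m] lt_m.
rewrite binomial_moment_falseS // !binomial_moment_true // bin_small; last by nia.
have [le_kn|lt_nk] := leqP k n; last by rewrite !mul0r mulr0 addr0.
by rewrite bin_small ?mulr0 ?addr0 //; nia.
Qed.

End Mean.

(** * The law of the outcomes *)

Section Probability.
Context {R : realType} {d : measure_display} {T : measurableType d}.
Variables (P : probability T R) (n : nat) (p : R) (X : 'I_n -> {RV P >-> bool}).
Hypotheses (p_ge0 : 0 <= p) (p_le1 : p <= 1) (X_trials : bernoulli_trials X p).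

Lemma trial_probability i (b : bool) :
  P (X i @^-1` [set b])%classic = (if b then p else 1 - p)%:E.
Proof.
have [_ /(_ i)] := X_trials; move=> /(_ [set b]%classic).
rewrite /distribution /pushforward /= => ->.
rewrite bernoulli_probE ?p_ge0 //.
have mem1 (a : bool) : (a \in [set b]%classic) = (a == b).
  by apply/idP/eqP => [/set_mem //|->]; apply: mem_set.
by rewrite !diracE !mem1; case: b {mem1}; rewrite /= mule1 mule0 ?adde0 ?add0e.
Qed.

Let outcome (x : {ffun 'I_n -> bool}) : set T :=
  (\bigcap_(i in [set` [set: 'I_n]%SET]) (X i @^-1` [set x i]))%classic.

(** This is the product rule of [mutually_independent] for the full family. *)
Lemma outcome_probability x :
  P (outcome x) = (\prod_(i < n) if x i then p else 1 - p)%:E.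
Proof.
have [X_indep _] := X_trials.
rewrite /outcome (X_indep [set: 'I_n]%SET (fun i => [set x i]%classic)) //.
rewrite -prodEFin; apply: eq_big => [i|i _]; first by rewrite finset.inE.
exact: trial_probability.
Qed.

Lemma outcomes_probability (A : pred {ffun 'I_n -> bool}) :
  P [set t | A [ffun i => X i t]]%classic =
    (\sum_(x | A x) \prod_(i < n) if x i then p else 1 - p)%:E.
Proof.
have outcomeE x t : outcome x t <-> [ffun i => X i t] = x.
  split=> [Xt|<- i _]; last by rewrite /= ffunE.
  by apply/ffunP => i; rewrite ffunE; apply: Xt; rewrite /= finset.inE.
have -> : [set t | A [ffun i => X i t]]%classic =
          (\bigcup_(x in [set` A]) outcome x)%classic.
  apply/seteqP; split=> t /=.
    by move=> At; exists [ffun i => X i t] => //; apply/outcomeE.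
  by move=> [x Ax /outcomeE->].
rewrite measure_fin_bigcup //=; last 2 first.
- move=> x y _ _ [t [/outcomeE<- /outcomeE<-]] //.
- move=> x _; apply: fin_bigcap_measurable => // i _.
  by rewrite -[X in measurable X]setTI; apply: measurable_funP.
rewrite -sumEFin (fsbigE (enum A)) ?enum_uniq //=.
- rewrite big_enum_cond /=; apply: eq_big => [x|x _]; last exact: outcome_probability.
  by rewrite mem_setE andbb.
- by move=> x /=; rewrite mem_enum.
- by move=> x /= Ax; rewrite mem_enum => /negP.
Qed.

End Probability.

Lemma run_number_probability (R : realType) (d : measure_display)
    (T : measurableType d) (P : probability T R) (k n r : nat) (p : R)
    (X : 'I_n -> {RV P >-> bool}) :
  (0 < k)%N -> 0 <= p -> p <= 1 -> bernoulli_trials X p ->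
  P [set t : T | M k X t = r]%classic =
  (trials_mean p n (fun s => (run_starts k false s == r)%:R))%:E.
Proof.
move=> k_gt0 p_ge0 p_le1 X_trials.
have -> : [set t : T | M k X t = r]%classic =
    [set t | [pred x | num_success_runs k x == r] [ffun i => X i t]]%classic.
  by apply/seteqP; split=> t /= /eqP.
rewrite (outcomes_probability p_ge0 p_le1 X_trials) trials_meanE; congr _%:E.
pose h (t : n.-tuple bool) := [ffun i => tnth t i].
pose h' (x : {ffun 'I_n -> bool}) := [tuple x i | i < n].
(* Outcomes as finite functions and as tuples are in bijection. *)
rewrite (reindex_onto h h') => [|x _]; last first.
  by apply/ffunP => i; rewrite ffunE tnth_mktuple.
rewrite big_mkcond; apply: eq_bigr => t _.
have -> : h' (h t) == t.
  by apply/eqP/eq_from_tnth => i; rewrite tnth_mktuple ffunE.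
rewrite andbT /= num_success_runsE //; case: eqP => _; last by rewrite mulr0.
by rewrite mulr1; apply: eq_bigr => i _; rewrite ffunE.
Qed.

(** * The distribution of the number of runs *)

Theorem mainTheorem11 (R : realType) (d : measure_display)
    (T : measurableType d) (P : probability T R) (k n r : nat) (p q : R)
    (X : 'I_n -> {RV P >-> bool})
    (k_ge1 : (1 <= k)%N) (n_ge1 : (1 <= n)%N)
    (p_gt0 : 0 < p) (p_lt1 : p < 1) (q_def : q = 1 - p)
    (X_trials : bernoulli_trials X p) :
  P [set t : T | M k X t = r]%classic =
  (\sum_(r <= m < ((n + 1) %/ (k + 1)).+1)
      (-1) ^+ (m - r)%N * 'C(m, r)%:R * p ^+ (m * k) * q ^ (m%:Z - 1) *
      ('C(n - m * k + 1, m)%:R - p * 'C(n - m * k, m)%:R))%:E.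
Proof.
have p_ge0 := ltW p_gt0; have p_le1 := ltW p_lt1.
have q_neq0 : 1 - p != 0 by rewrite subr_eq0 gt_eqF.
rewrite (run_number_probability _ _ p_ge0 p_le1 X_trials) //; congr _%:E.
rewrite (eq_trials_mean p (g := fun s => \sum_(r <= m < n.+1)
    (-1) ^+ (m - r) * 'C(m, r)%:R * 'C(run_starts k false s, m)%:R)); last first.
  move=> s sz_s; apply: indicator_binomial_inversion.
  by rewrite ltnS -sz_s run_starts_leq_size.
rewrite trials_mean_sum.
(* The summands between the stated upper limit and n are zero. *)
have le_Un : (((n + 1) %/ (k + 1)).+1 <= n.+1)%N.
  by rewrite -[X in (_ <= X)%N]addn1 ltn_Pdiv ?addn1.
rewrite [RHS](big_nat_widen _ _ _ _ _ le_Un) [RHS]big_mkcond.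
apply: eq_big_nat => m /andP[le_rm _]; rewrite -/(binomial_moment p k false n m).
rewrite ltnS leq_divRL ?addn1 //.
have [le_m|lt_m] := leqP (m * k.+1) n.+1; last first.
  by rewrite binomial_moment_false_eq0 ?mulr0.
apply: (mulfI q_neq0); rewrite mulrCA binomial_moment_false // q_def.
rewrite expfzDr // -exprnP exprN1 addn1.
by field.
Qed.
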